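(* Let $n\geq 5$ and let $f:E(K_n)\to\{-1,1\}$ be a weighting with $|f^{-1}(1)|=h(n)-1$, where $h(n)=n+1$ if $n\equiv 0\pmod 4$ and $h(n)=n$ otherwise. Then there is no copy $H$ of $K_4$ in $K_n$ with $\sum_{e\in E(H)}f(e)=0$ if and only if the graph on vertex set $V(K_n)$ with edge set $f^{-1}(1)$ is isomorphic to the disjoint union $J\cup\bigcup_{i=1}^{q}C_4$ of $J$ and $q$ copies of $C_4$, where $J\in\{\emptyset,K_1,K_2,P_2\}$ and $q=\lfloor n/4\rfloor$.
   Context: $K_n$ is the complete graph on $n$ vertices. $C_4$ is the cycle with 4 edges, $P_2$ the path with 2 edges, $K_1$ a single vertex, $K_2$ a single edge, and $\emptyset$ the empty graph (no vertices). *)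

(* Defs.v *)
From HB Require Import structures.
From mathcomp Require Import all_boot all_order all_algebra.

Set Implicit Arguments.
Unset Strict Implicit.
Unset Printing Implicit Defensive.

Import Order.TTheory GRing.Theory Num.Theory.

Record sgraph := SGraph {
  vertex : finType;
  adj : rel vertex;
  adj_sym : symmetric adj;
  adj_irr : irreflexive adj }.

Definition edges (G : sgraph) : {set {set vertex G}} :=
  [set e | [exists x : vertex G, exists y : vertex G,
              adj x y && (e == [set x; y])]].

Notation edge G := {e : {set vertex G} | e \in edges G}.

Definition isomorphic (G H : sgraph) : Prop :=
  exists2 phi : vertex G -> vertex H, bijective phi &
    forall x y, adj (phi x) (phi y) = adj x y.

Record subgraph (G : sgraph) := Subgraph {
  sub_vertices : {set vertex G};
  sub_edges : {set edge G};
  sub_edgesP : forall e, e \in sub_edges -> val e \subset sub_vertices }.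

Section SubgraphAsGraph.
Variables (G : sgraph) (H : subgraph G).

Definition sub_adj : rel {x : vertex G | x \in sub_vertices H} :=
  fun x y => [exists e in sub_edges H, val e == [set val x; val y]].

Lemma sub_adj_sym : symmetric sub_adj.
Proof. by move=> x y; apply: eq_existsb => e; rewrite setUC. Qed.

Lemma sub_adj_irr : irreflexive sub_adj.
Proof.
move=> x; apply/existsP => -[[e /= Ee] /andP [_ /= /eqP De]].
move: Ee; rewrite inE => /existsP [y /existsP [z /andP [yz /eqP Dyz]]].
have : y \in e by rewrite Dyz set21.
have : z \in e by rewrite Dyz set22.
rewrite De setUid !inE => /eqP zx /eqP yx.
by move: yz; rewrite zx yx adj_irr.
Qed.

Definition graph_of_subgraph : sgraph := SGraph sub_adj_sym sub_adj_irr.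

End SubgraphAsGraph.

Coercion graph_of_subgraph : subgraph >-> sgraph.

Lemma spanning_subproof (G : sgraph) (F : {set edge G}) e :
  e \in F -> val e \subset [set: vertex G].
Proof. by move=> _; apply: subsetT. Qed.

Definition spanning_subgraph (G : sgraph) (F : {set edge G}) : subgraph G :=
  Subgraph (@spanning_subproof G F).

Definition complete_adj n : rel 'I_n := fun i j => i != j.

Lemma complete_sym n : symmetric (@complete_adj n).
Proof. by move=> i j; rewrite /complete_adj eq_sym. Qed.

Lemma complete_irr n : irreflexive (@complete_adj n).
Proof. by move=> i; rewrite /complete_adj eqxx. Qed.

Definition complete_graph n : sgraph :=
  SGraph (@complete_sym n) (@complete_irr n).

(* k counts edges, so the path has k.+1 vertices. *)
Definition path_adj k : rel 'I_k.+1 :=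
  fun i j => (i.+1 == j :> nat) || (j.+1 == i :> nat).

Lemma path_sym k : symmetric (@path_adj k).
Proof. by move=> i j; rewrite /path_adj orbC. Qed.

Lemma path_irr k : irreflexive (@path_adj k).
Proof. by move=> i; rewrite /path_adj orbb gtn_eqF. Qed.

Definition path_graph k : sgraph := SGraph (@path_sym k) (@path_irr k).

(* This is the usual cycle only for k >= 3; the conjunct i != j only matters
   for k = 1. *)
Definition cycle_adj k : rel 'I_k :=
  fun i j => (i != j) && ((i.+1 %% k == j) || (j.+1 %% k == i)).

Lemma cycle_sym k : symmetric (@cycle_adj k).
Proof. by move=> i j; rewrite /cycle_adj eq_sym orbC. Qed.

Lemma cycle_irr k : irreflexive (@cycle_adj k).
Proof. by move=> i; rewrite /cycle_adj eqxx. Qed.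

Definition cycle_graph k : sgraph := SGraph (@cycle_sym k) (@cycle_irr k).

Section Unions.
Variables (G H : sgraph) (q : nat).

Definition union_adj : rel (vertex G + vertex H)%type := fun x y =>
  match x, y with
  | inl a, inl b => adj a b
  | inr a, inr b => adj a b
  | _, _ => false
  end.

Lemma union_sym : symmetric union_adj.
Proof. by move=> [a|a] [b|b] //=; apply: adj_sym. Qed.

Lemma union_irr : irreflexive union_adj.
Proof. by move=> [a|a] /=; apply: adj_irr. Qed.

Definition disjoint_union : sgraph := SGraph union_sym union_irr.

Definition copies_adj : rel ('I_q * vertex G)%type :=
  fun x y => (x.1 == y.1) && adj x.2 y.2.

Lemma copies_sym : symmetric copies_adj.
Proof. by move=> x y; rewrite /copies_adj eq_sym adj_sym. Qed.

Lemma copies_irr : irreflexive copies_adj.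
Proof. by move=> x; rewrite /copies_adj adj_irr andbF. Qed.

Definition disjoint_copies : sgraph := SGraph copies_sym copies_irr.

End Unions.

Definition h (n : nat) : nat := if n %% 4 == 0 then n.+1 else n.

(* Main.v *)
(** Write G for the graph of positive edges; a copy of K_4 has sum 0 iff its four
    vertices span exactly three edges of G. Suppose that no four vertices do.
    If G had a triangle, every other vertex would be joined to it, and checking
    the four-subsets shows that the triangle and any two further vertices span
    at least 6 edges; so G would have at least 6 + (n - 5) > n edges. Hence G is
    triangle-free. As claws and induced 3-edge paths are excluded, all degrees
    are at most 2 and every 3-edge path closes up to a C_4. Since G has at least
    n - 1 edges, the sum of 2 - deg over all vertices is at most 2. Removing the
    C_4 components one by one leaves a graph without 3-edge paths and with the
    same total deficiency, which has at most three vertices.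
    Conversely, K_{1,3}, P_3 and K_3 + K_1 are the only graphs with four vertices
    and three edges, and none of them is induced in a disjoint union of C_4 and J. *)

Require Import Defs.
From mathcomp Require Import all_boot all_order all_algebra.
From mathcomp Require Import zify.
Import Order.TTheory GRing.Theory Num.Theory.

Local Open Scope ring_scope.

(** * Four-vertex configurations and thin relations *)

Definition no_three_edges {T : finType} (e : rel T) : Prop :=
  forall a b c d, uniq [:: a; b; c; d] ->
    (e a b + e a c + e a d + e b c + e b d + e c d != 3)%N.

Definition triangle_free {T : finType} (e : rel T) : Prop :=
  forall a b c, e a b -> e b c -> ~~ e a c.

Definition claw_free {T : finType} (e : rel T) : Prop :=
  forall a b c d, e a b -> e a c -> e a d -> [|| b == c, b == d | c == d].

Definition paths_close {T : finType} (e : rel T) : Prop :=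
  forall a b c d, e a b -> e b c -> e c d -> a != c -> b != d -> e a d.

(** For symmetric irreflexive [e], every component is then a 4-cycle or a path with at most two
    edges. *)
Definition thin {T : finType} (e : rel T) : Prop :=
  [/\ triangle_free e, claw_free e & paths_close e].

Lemma thin_no_three_edges {T : finType} {e : rel T} :
  symmetric e -> thin e -> no_three_edges e.
Proof.
move=> es [tf cf pc] a b c d /=; rewrite !inE !negb_or !andbT => /and3P[].
move=> /and3P[ab ac ad] /andP[bc bd] cd.
have ne := (negbTE ab, negbTE ac, negbTE ad, negbTE bc, negbTE bd, negbTE cd).
have := (tf a b c, tf a b d, tf a c d, tf b c d).
have := (cf a b c d, cf b a c d, cf c a b d, cf d a b c).
(* These are the twelve 3-edge paths on four vertices up to reversal; with the four triangles and
   four claws above they refute every pattern of exactly three edges. *)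
have := ((pc a b c d, pc a b d c, pc a c b d, pc a c d b, pc a d b c, pc a d c b),
  (pc b a c d, pc b a d c, pc b c a d, pc b d a c, pc c a b d, pc c b a d)).
rewrite (es b a) (es c a) (es c b) (es d a) (es d b) (es d c).
rewrite ?(eq_sym b a) ?(eq_sym c a) ?(eq_sym c b) ?(eq_sym d a) ?(eq_sym d b) ?(eq_sym d c) !ne /=.
by case: (e a b); case: (e a c); case: (e a d); case: (e b c); case: (e b d);
  case: (e c d) => //= h1 h2 h3; exfalso; move: h1 h2 h3; intuition (auto; discriminate).
Qed.

(** Without triangles, a claw or a 3-edge path with non-adjacent ends has no further edge among its
    four vertices, so it spans exactly three. *)
Lemma no_three_edges_thin {T : finType} {e : rel T} :
  symmetric e -> irreflexive e -> no_three_edges e -> triangle_free e -> thin e.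
Proof.
move=> es ei nt tf; split=> // a b c d.
- move=> ab ac ad; apply/negPn/negP; rewrite !negb_or => /and3P[bc bd cd].
  have ne x y : e x y -> x != y by apply: contraTneq => ->; rewrite ei.
  have := nt a b c d; rewrite /= !inE !negb_or (ne _ _ ab) (ne _ _ ac) (ne _ _ ad) bc bd cd ab ac ad.
  have tfa x y : e a x -> e a y -> e x y = false.
    by move=> ax ay; apply/negbTE/(tf x a y); rewrite // es.
  by rewrite (tfa _ _ ab ac) (tfa _ _ ab ad) (tfa _ _ ac ad) => /(_ isT).
- move=> ab bc cd ac bd; apply/negPn/negP => ad.
  have ne x y : e x y -> x != y by apply: contraTneq => ->; rewrite ei.
  have nad : a != d by apply: contraTneq cd => <-; rewrite es; apply: tf ab bc.
  have := nt a b c d; rewrite /= !inE !negb_or (ne _ _ ab) (ne _ _ bc) (ne _ _ cd) ac bd nad ab bc cd.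
  by rewrite (negbTE ad) (negbTE (tf _ _ _ ab bc)) (negbTE (tf _ _ _ bc cd)) => /(_ isT).
Qed.

(** * Exclusion of triangles by counting ordered pairs *)

(** Pairs between [s] and its complement occur in both orders; pairs avoiding [s] are dropped. *)
Lemma sum_rel_split {T : finType} {e : rel T} {s : seq T} :
  symmetric e -> uniq s ->
  (\sum_(x <- s) \sum_(y <- s) e x y
     + (\sum_(x | x \notin s) \sum_(y <- s) e x y).*2
     <= \sum_x \sum_y e x y)%N.
Proof.
move=> es us.
rewrite [leqRHS](bigID [in s]) /= -big_uniq //.
have splt x : (\sum_y e x y = \sum_(y <- s) e x y + \sum_(y | y \notin s) e x y)%N.
  by rewrite (bigID [in s]) /= -big_uniq.
under [X in (_ <= X + _)%N]eq_bigr => x _ do rewrite splt.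
rewrite big_split /= -addnA leq_add2l -addnn leq_add //.
  rewrite exchange_big /=; apply: leq_sum => x _.
  by apply: leq_sum => y _; rewrite es.
by apply: leq_sum => x _; rewrite splt leq_addr.
Qed.

Lemma no_three_edges_triangle_free {T : finType} {e : rel T} :
  symmetric e -> irreflexive e -> (5 <= #|T|)%N -> no_three_edges e ->
  (\sum_x \sum_y e x y <= #|T|.*2)%N -> triangle_free e.
Proof.
move=> es ei T5 nt sume a b c ab bc; apply/negP => ac.
have ne x y : e x y -> x != y by apply: contraTneq => ->; rewrite ei.
have uabc : uniq [:: a; b; c] by rewrite /= !inE !negb_or (ne _ _ ab) (ne _ _ ac) (ne _ _ bc).
(* A vertex with no neighbour in the triangle would span exactly three edges with it. *)
have meets x : x \notin [:: a; b; c] -> (0 < e x a + e x b + e x c)%N.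
  rewrite !inE !negb_or => /and3P[xa xb xc].
  have := nt x a b c; rewrite /= !inE !negb_or xa xb xc (ne _ _ ab) (ne _ _ ac) (ne _ _ bc) ab bc ac.
  by move=> /(_ isT); case: (e x a); case: (e x b); case: (e x c).
have : (1 < #|[predC [in [:: a; b; c]]]|)%N.
  by move: T5; rewrite -(cardC [in [:: a; b; c]]) (card_uniqP uabc) addSn !ltnS.
case/card_gt1P=> v [w []] vN wN vw.
pose s := [:: a; b; c; v; w].
have us : uniq s.
  move: uabc vN wN vw; rewrite /s /= !inE !negb_or !andbT (eq_sym v a) (eq_sym v b) (eq_sym v c).
  rewrite (eq_sym w a) (eq_sym w b) (eq_sym w c).
  by move=> /andP[/andP[-> ->] ->] /and3P[-> -> ->] /and3P[-> -> ->] ->.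
(* Twelve is six edges in both orders. If [v] and [w] were non-adjacent with one neighbour each in
   the triangle, they and two triangle vertices including these neighbours would span exactly three
   edges. *)
have inner : (12 <= \sum_(x <- s) \sum_(y <- s) e x y)%N.
  have := (meets v vN, meets w wN).
  move: us; rewrite /s /= !inE !negb_or !andbT => /and4P[].
  move=> /and4P[nab nac nav naw] /and3P[nbc nbv nbw] /andP[ncv ncw] nvw.
  have := (nt a b v w, nt a c v w, nt b c v w).
  rewrite /= !inE !negb_or nab nac nav naw nbc nbv nbw ncv ncw nvw ab bc ac /=.
  rewrite !big_cons !big_nil !ei (es v a) (es v b) (es v c) (es w a) (es w b) (es w c) (es w v).
  rewrite (es b a) (es c a) (es c b) ab bc ac /=.
  by case: (e a v); case: (e b v); case: (e c v); case: (e a w); case: (e b w);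
    case: (e c w); case: (e v w) => //= - [[/(_ isT) + /(_ isT) +] /(_ isT) +] [].
have outer : (#|T| - 5 <= \sum_(x | x \notin s) \sum_(y <- s) e x y)%N.
  have <- : #|[predC [in s]]| = (#|T| - 5)%N.
    by rewrite -(cardC [in s]) (card_uniqP us) addKn.
  rewrite -sum1_card; apply: leq_sum => x xs.
  have /meets : x \notin [:: a; b; c].
    by apply: contra xs; rewrite !inE => /or3P[] ->; rewrite ?orbT.
  by rewrite !big_cons; case: (e x a); case: (e x b); case: (e x c).
(* The total is at least 12 plus twice [#|T| - 5], which exceeds [#|T|.*2]. *)
have := sum_rel_split es us; lia.
Qed.

(** * Induced copies of graphs and of disjoint unions *)

(** An isomorphism from [G] onto the relation induced on all of [A]. Staying inside a fixed [T] lets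
    an induction remove vertices without changing the type. *)
Definition embeds (G : sgraph) {T : finType} (e : rel T) (A : {set T}) : Prop :=
  exists phi : vertex G -> T,
    [/\ injective phi, codom phi =i A & forall u v, e (phi u) (phi v) = adj u v].

Lemma embeds_tuple (k : nat) (r : rel 'I_k) (rs : symmetric r)
    (ri : irreflexive r) (T : finType) (e : rel T) (t : k.-tuple T) :
  uniq t -> (forall i j, e (tnth t i) (tnth t j) = r i j) ->
  embeds (SGraph rs ri) e [set x in t].
Proof.
move=> /tuple_uniqP ut et; exists (tnth t); split=> // x.
rewrite inE; apply/codomP/tnthP => -[i ->]; by exists i.
Qed.

Lemma embeds_copies0 (J C : sgraph) (T : finType) (e : rel T) (A : {set T}) :
  embeds J e A -> embeds (disjoint_union J (disjoint_copies C 0)) e A.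
Proof.
case=> phi [phi_inj imA phiE].
exists (fun u : vertex J + 'I_0 * vertex C =>
  match u with inl x => phi x | inr (i, _) => match notF (ltn_ord i) with end end).
split.
- by move=> [x|[[]//]] [y|[[]//]] /phi_inj ->.
- move=> x; rewrite -imA; apply/codomP/codomP => -[].
    by case=> [u|[[]//]] ->; exists u.
  by move=> u ->; exists (inl u).
- by move=> [x|[[]//]] [y|[[]//]] /=.
Qed.

Lemma embeds_copiesS (J C : sgraph) (q : nat) (T : finType) (e : rel T)
    (A S : {set T}) :
  symmetric e -> [disjoint A & S] ->
  (forall x y, x \in A -> y \in S -> e x y = false) ->
  embeds (disjoint_union J (disjoint_copies C q)) e A -> embeds C e S ->
  embeds (disjoint_union J (disjoint_copies C q.+1)) e (A :|: S).
Proof.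
move=> es dAS nAS [phi [phi_inj imA phiE]] [psi [psi_inj imS psiE]].
have phiA u : phi u \in A by rewrite -imA codom_f.
have psiS u : psi u \in S by rewrite -imS codom_f.
have phi_psi u v : phi u <> psi v.
  by move=> uv; have := disjointFr dAS (phiA u); rewrite uv psiS.
(* Copy [ord0] goes to [S] by [psi]; copy [lift ord0 j] goes where [phi] sends copy [j]. *)
pose chi (u : vertex J + 'I_q.+1 * vertex C) := match u with
  | inl x => phi (inl x)
  | inr (i, x) => if unlift ord0 i is Some j then phi (inr (j, x)) else psi x
  end.
exists chi; split.
- move=> [x|[i x]] [y|[j y]] /=.
  + by move=> /phi_inj[->].
  + by case: unliftP => [j'|] _; [move=> /phi_inj | move=> /phi_psi].
  + by case: unliftP => [i'|] _; [move=> /phi_inj | move=> /esym/phi_psi].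
  + case: unliftP => [i'|] ->; case: unliftP => [j'|] -> //.
    * by move=> /phi_inj [-> ->].
    * by move=> /phi_psi.
    * by move=> /esym/phi_psi.
    * by move=> /psi_inj ->.
- move=> x; rewrite inE -imA -imS; apply/codomP/orP.
    case=> -[u|[i u]] -> /=; first by left; apply: codom_f.
    by case: unliftP => [j|] _; [left | right]; apply: codom_f.
  case=> /codomP[] => [[u|[i u]]|u] ->; first by exists (inl u).
    by exists (inr (lift ord0 i, u)); rewrite /= liftK.
  by exists (inr (ord0, u)); rewrite /= unlift_none.
- move=> [x|[i x]] [y|[j y]] /=.
  + by rewrite phiE.
  + by case: unliftP => [j'|] _; rewrite ?phiE // nAS.
  + by case: unliftP => [i'|] _; rewrite ?phiE // es nAS.
  + rewrite /copies_adj /=; case: unliftP => [i'|] ->; case: unliftP => [j'|] ->.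
    * by rewrite phiE /= /copies_adj /= (inj_eq lift_inj).
    * by rewrite nAS.
    * by rewrite es nAS.
    * by rewrite psiE eqxx.
Qed.

(** * Structure of thin relations with total deficiency at most 2 *)

Definition small_part (J : sgraph) : Prop :=
  J = complete_graph 0 \/ J = complete_graph 1 \/
  J = complete_graph 2 \/ J = path_graph 2.

Lemma sum_uniq_le {T : finType} {A : {set T}} (s : seq T) (F : T -> nat) :
  uniq s -> {subset s <= A} -> (\sum_(x <- s) F x <= \sum_(x in A) F x)%N.
Proof.
move=> us sA; rewrite big_uniq //= [leqRHS](bigID [in s]) /=.
rewrite [X in (_ <= X + _)%N](eq_bigl [in s]) ?leq_addr // => x.
by apply/andb_idl/sA.
Qed.

(** If some vertex has two neighbours, these are leaves and use up the whole deficiency 2, which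
    leaves room for nothing else. Otherwise every vertex has deficiency at least 1, so there are at
    most two, and two of them must be adjacent. *)
Lemma small_part_embeds (T : finType) (e : rel T) (A : {set T}) :
  symmetric e -> irreflexive e -> triangle_free e ->
  (forall x y, e x y -> x \in A -> y \in A) ->
  (forall x y z w, x \in A -> e x y -> e y z -> e z w -> x != z -> y = w) ->
  (\sum_(x in A) (2 - #|[set y | e x y]|) <= 2)%N ->
  exists2 J, small_part J & embeds J e A.
Proof.
move=> es ei tf Acl nopath def.
pose d x := (2 - #|[set y | e x y]|)%N.
have defs s : uniq s -> {subset s <= A} -> (\sum_(x <- s) d x <= 2)%N.
  by move=> us sA; apply: leq_trans def; apply: sum_uniq_le.
have ne x y : e x y -> x != y by apply: contraTneq => ->; rewrite ei.
(* Another neighbour [t] of [y] would give the 3-edge path [t], [y], [x], [z]. *)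
have leaf x y z t : x \in A -> e x y -> e x z -> y != z -> e y t -> t = x.
  move=> xA xy xz yz yt; apply/eqP/negPn/negP => tx; apply/negP: yz; rewrite negbK.
  have tA : t \in A := Acl _ _ yt (Acl _ _ xy xA).
  by apply/eqP/(nopath t y x z) => //; rewrite es.
have dleaf x y z : x \in A -> e x y -> e x z -> y != z -> d y = 1%N.
  move=> xA xy xz yz; rewrite /d (_ : [set t | e y t] = [set x]) ?cards1 //.
  apply/setP => t; rewrite !inE; apply/idP/eqP => [|->]; last by rewrite es.
  exact: leaf xy xz yz.
have [/exists_inP[x xA /existsP[y /existsP[z /and3P[xy xz yz]]]]|noV] :=
  boolP [exists x in A, exists y, exists z, [&& e x y, e x z & y != z]].
  have yA := Acl _ _ xy xA; have zA := Acl _ _ xz xA.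
  have dy := dleaf _ _ _ xA xy xz yz.
  have zy : z != y by rewrite eq_sym.
  have dz := dleaf _ _ _ xA xz xy zy.
  have Axyz : [set t in [tuple y; x; z]] = A.
    apply/setP => u; rewrite !inE; apply/idP/idP => [/or3P[]/eqP->//|uA].
    apply/negPn/negP; rewrite !negb_or => /and3P[uy ux uz].
    (* No deficiency is left for [u], so it has two neighbours. One of them, [s], is then a third
       leaf besides [y] and [z], and the deficiency reaches 3. *)
    have: (1 < #|[set t | e u t]|)%N.
      have := defs [:: y; z; u].
      rewrite /= !inE !negb_or yz (eq_sym y) uy (eq_sym z) uz !big_cons big_nil dy dz.
      have sA : {subset [:: y; z; u] <= A} by move=> v; rewrite !inE => /or3P[]/eqP->.
      by move=> /(_ isT sA); rewrite /d; case: #|_| => [|[]].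
    case/card_gt1P => s [t []]; rewrite !inE => us ut st.
    have sy : y != s.
      by apply: contraNneq ux => sy; apply/eqP/(leaf x y z); rewrite // sy es.
    have sz : z != s.
      by apply: contraNneq ux => sz; apply/eqP/(leaf x z y); rewrite // sz es.
    have sA := Acl _ _ us uA.
    have := defs [:: y; z; s].
    rewrite /= !inE !negb_or yz sy sz !big_cons big_nil dy dz (dleaf u s t) //.
    have subA : {subset [:: y; z; s] <= A} by move=> v; rewrite !inE => /or3P[]/eqP->.
    by move=> /(_ isT subA).
  exists (path_graph 2); first by do 3!right.
  rewrite -Axyz; apply: embeds_tuple.
    by rewrite /= !inE negb_or yz (eq_sym y) !(ne x).
  have nyz : e y z = false by apply/negbTE/(tf y x z); rewrite // es.
  move=> [[|[|[|i]]] //= lti] [[|[|[|j]]] //= ltj];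
    by rewrite !(tnth_nth x) /path_adj /= ?ei ?(es y x) ?(es z) ?xy ?xz ?nyz.
have deg1 x y z : x \in A -> e x y -> e x z -> y = z.
  move=> xA xy xz; apply/eqP/negPn/negP => yz; case/negP: noV.
  by apply/exists_inP; exists x => //; apply/existsP; exists y; apply/existsP; exists z; rewrite xy xz.
have deg_le1 x : x \in A -> (#|[set y | e x y]| <= 1)%N.
  by move=> xA; apply/card_le1_eqP => y z; rewrite !inE => xy xz; exact: (deg1 x).
have := enum_uniq A; have := mem_enum A; case: (enum A) => [|a [|b s]] sA us.
- exists (complete_graph 0); first by left.
  have -> : A = [set t in [tuple]] by apply/setP => t; rewrite -sA inE.
  by apply: embeds_tuple => // -[].
- exists (complete_graph 1); first by right; left.
  have -> : A = [set t in [tuple a]] by apply/setP => t; rewrite -sA inE.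
  by apply: embeds_tuple => // i j; rewrite !ord1 /complete_adj eqxx ei.
have aA : a \in A by rewrite -sA mem_head.
have bA : b \in A by rewrite -sA !inE eqxx orbT.
have subA : {subset [:: a, b & s] <= A} by move=> t; rewrite sA.
have := defs _ us subA.
rewrite !big_cons => ds.
have [da db s0] : [/\ d a = 1, d b = 1 & s = [::]]%N.
  have d0 x : x \in A -> (0 < d x)%N by move=> /deg_le1; rewrite /d subn_gt0.
  have := d0 a aA; have := d0 b bA; case: s sA us ds {subA} => [|c s] sA us.
    by rewrite big_nil => *; split=> //; lia.
  have cA : c \in A by rewrite -sA !inE eqxx !orbT.
  by have := d0 c cA; rewrite big_cons; lia.
have ab : e a b.
  have: (0 < #|[set y | e a y]|)%N by move: da; rewrite /d; case: #|_|.
  case/card_gt0P => y; rewrite inE => ay; have := Acl _ _ ay aA.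
  by rewrite -sA s0 !inE eq_sym (negbTE (ne _ _ ay)) => /eqP <-.
exists (complete_graph 2); first by do 2!right; left.
have -> : A = [set t in [tuple a; b]] by apply/setP => t; rewrite -sA s0 inE.
apply: embeds_tuple; first by move: us; rewrite s0.
by move=> [[|[|i]] //= lti] [[|[|j]] //= ltj]; rewrite !(tnth_nth a) /complete_adj /= ?ei ?(es b) ?ab.
Qed.

(** Strong induction on [#|A|]: a 3-edge path closes to a 4-cycle, which is split off as a
    component. As [A] is closed under adjacency, degrees never change. *)
Lemma thin_decomposition (T : finType) (e : rel T) (A : {set T}) :
  symmetric e -> irreflexive e -> thin e ->
  (forall x y, e x y -> x \in A -> y \in A) ->
  (\sum_(x in A) (2 - #|[set y | e x y]|) <= 2)%N ->
  exists J q, small_part J /\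
    embeds (disjoint_union J (disjoint_copies (cycle_graph 4) q)) e A.
Proof.
move=> es ei et; have [tf cf pc] := et.
have ne x y : e x y -> x != y by apply: contraTneq => ->; rewrite ei.
have [m] := ubnP #|A|; elim: m A => // m IHm A ltAm Acl def.
have [/exists_inP[x xA /existsP[y /existsP[z /existsP[w]]]]|noP] := boolP
  [exists x in A, exists y, exists z, exists w,
     [&& e x y, e y z, e z w, x != z & y != w]]; last first.
  have [|J sJ AJ] := small_part_embeds _ _ _ es ei tf Acl _ def.
    move=> x y z w xA xy yz zw xz; apply/eqP/negPn/negP => yw; case/negP: noP.
    apply/exists_inP; exists x => //; apply/existsP; exists y; apply/existsP.
    by exists z; apply/existsP; exists w; rewrite xy yz zw xz yw.
  by exists J, 0%N; split=> //; apply: embeds_copies0.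
case/and5P=> xy yz zw xz yw; have xw := pc _ _ _ _ xy yz zw xz yw.
pose S := [set t in [tuple x; y; z; w]].
(* Each vertex of the cycle has two neighbours on it, and claw-freeness forbids a third. *)
have Scl s t : e s t -> s \in S -> t \in S.
  have two a b c u : e a b -> e a c -> b != c -> e a u -> (u == b) || (u == c).
    by move=> ab ac bc au; have := cf _ _ _ _ ab ac au; rewrite (negbTE bc) !(eq_sym u).
  rewrite !inE => st /or4P[]/eqP es'; move: st; rewrite es'.
  - by move/(two _ _ _ _ xy xw yw) => /orP[] ->; rewrite ?orbT.
  - by rewrite es in xy; move/(two _ _ _ _ xy yz xz) => /orP[] ->; rewrite ?orbT.
  - by rewrite es in yz; move/(two _ _ _ _ yz zw yw) => /orP[] ->; rewrite ?orbT.
  - rewrite es in xw; rewrite es in zw.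
    by move/(two _ _ _ _ xw zw xz) => /orP[] ->; rewrite ?orbT.
have SA : S \subset A.
  have yA := Acl _ _ xy xA; have zA := Acl _ _ yz yA; have wA := Acl _ _ zw zA.
  by apply/subsetP => t; rewrite !inE => /or4P[]/eqP->.
have xS : x \in S by rewrite !inE eqxx.
have [||| J [q [sJ AJ]]] := IHm (A :\: S).
- rewrite -ltnS; apply: leq_trans ltAm; rewrite ltnS; apply: proper_card; apply/properP; split.
    exact: subsetDl.
  by exists x => //; rewrite inE xS.
- move=> s t st; rewrite !in_setD => /andP[nsS sA].
  rewrite (Acl _ _ st sA) andbT; by apply: contra nsS; apply: Scl; rewrite es.
- apply: leq_trans def; rewrite [leqRHS](big_setID S) /=.
  exact: leq_addl.
exists J, q.+1; split=> //.
have -> : A = (A :\: S) :|: S by rewrite -{1}(setID A S) (setIidPr SA) setUC.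
apply: embeds_copiesS => //.
- by rewrite -setI_eq0; apply/eqP/setP => t; rewrite in_setI in_setD in_set0; case: (t \in S); rewrite ?andbF.
- move=> s t; rewrite in_setD => /andP[nsS _] tS; apply/negbTE.
  by apply: contra nsS => st; apply: Scl tS; rewrite es.
apply: embeds_tuple.
  by rewrite /= !inE !negb_or xz yw (ne _ _ xy) (ne _ _ yz) (ne _ _ zw) (ne _ _ xw).
(* The 4-cycle has no chords, since a chord would create a triangle. *)
have nxz := negbTE (tf _ _ _ xy yz); have nyw := negbTE (tf _ _ _ yz zw).
move=> [[|[|[|[|i]]]] //= lti] [[|[|[|[|j]]]] //= ltj]; rewrite !(tnth_nth x) /cycle_adj /= ?ei;
 by rewrite ?xy ?yz ?zw ?xw ?nxz ?nyw // es ?xy ?yz ?zw ?xw ?nxz ?nyw.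
Qed.

Local Open Scope ring_scope.

(** * Sums over edges as double sums over vertices *)

(** The value 0 off the edges, loops included, allows sums over unrestricted pairs of vertices. *)
Definition at_pair {G : sgraph} {V : nmodType} (g : edge G -> V)
    (x y : vertex G) : V := oapp g 0 (insub [set x; y]).

Lemma at_pair_sym {G : sgraph} {V : nmodType} (g : edge G -> V) x y :
  at_pair g x y = at_pair g y x.
Proof. by rewrite /at_pair setUC. Qed.

Lemma adj_edges {G : sgraph} {x y : vertex G} : adj x y -> [set x; y] \in edges G.
Proof.
by move=> xy; rewrite inE; apply/existsP; exists x; apply/existsP; exists y; rewrite xy eqxx.
Qed.

Lemma edgeP {G : sgraph} (e : edge G) :
  exists x y : vertex G, adj x y /\ val e = [set x; y].
Proof.
have := valP e; rewrite inE => /existsP[x /existsP[y /andP[xy /eqP ->]]].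
by exists x, y.
Qed.

Lemma at_pairE {G : sgraph} {V : nmodType} (g : edge G -> V) {x y} (xy : adj x y) :
  at_pair g x y = g (Sub [set x; y] (adj_edges xy)).
Proof.
rewrite /at_pair; case: insubP => [e _ De|/negP[]]; last exact: adj_edges.
by congr (g _); apply: val_inj.
Qed.

Lemma sum_at_pair {G : sgraph} {V : nmodType} (g : edge G -> V) :
  \sum_x \sum_y at_pair g x y = (\sum_e g e) *+ 2.
Proof.
rewrite pair_big /=.
(* The inner sum has at most one term. After exchanging the sums, each edge is counted for its two
   orderings. *)
transitivity (\sum_(p : vertex G * vertex G) \sum_(e | val e == [set p.1; p.2]) g e).
  apply: eq_bigr => -[x y] _ /=; rewrite /at_pair; case: insubP => [e _ <-|nE] /=.
    by rewrite (eq_bigl (pred1 e)) ?big_pred1_eq // => e'; rewrite (inj_eq val_inj).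
  by rewrite big1 // => e /eqP De; case/negP: nE; rewrite -De (valP e).
rewrite (exchange_big_dep predT) //= -sumrMnl; apply: eq_bigr => e _.
have [a [b [ab ->]]] := edgeP e.
have nab : a != b by apply: contraTneq ab => ->; rewrite adj_irr.
rewrite sumr_const; congr (_ *+ _).
transitivity #|[set (a, b); (b, a)]|; last by rewrite cards2 xpair_eqE negb_and nab.
apply: eq_card => -[x y]; rewrite !inE !xpair_eqE -[LHS]/([set a; b] == [set x; y]).
apply/eqP/orP => [abxy|[/andP[/eqP-> /eqP->]|/andP[/eqP-> /eqP->]]] //; last by rewrite setUC.
have eq_ab_xy t : (t \in [set a; b]) = (t \in [set x; y]) by move/setP: abxy.
have := set21 a b; have := set22 a b; rewrite !eq_ab_xy.
have := set21 x y; have := set22 x y; rewrite -2!eq_ab_xy.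
rewrite !inE => /orP[]/eqP-> /orP[]/eqP->;
  by rewrite ?(eq_sym b) ?eqxx ?(negbTE nab) //=; auto.
Qed.

(** * Thinness of the extremal graphs *)

Lemma thin_relpre {T U : finType} {e : rel U} (phi : T -> U) :
  injective phi -> thin e -> thin (relpre phi e).
Proof.
move=> inj_phi [tf cf pc]; split=> [a b c|a b c d|a b c d] /=; first exact: tf.
  by rewrite -!(inj_eq inj_phi); apply: cf.
by rewrite -!(inj_eq inj_phi); apply: pc.
Qed.

(** The premises of each condition connect all vertices involved, so these lie in one summand. *)
Lemma thin_disjoint_union (G H : sgraph) :
  thin (@adj G) -> thin (@adj H) -> thin (@adj (disjoint_union G H)).
Proof.
move=> [tfG cfG pcG] [tfH cfH pcH]; split.
- by move=> [a|a] [b|b] [c|c] //=; [apply: tfG | apply: tfH].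
- by move=> [a|a] [b|b] [c|c] [d|d] //=; [apply: cfG | apply: cfH].
- by move=> [a|a] [b|b] [c|c] [d|d] //=; [apply: pcG | apply: pcH].
Qed.

Lemma thin_disjoint_copies (G : sgraph) (q : nat) :
  thin (@adj G) -> thin (@adj (disjoint_copies G q)).
Proof.
move=> [tf cf pc]; split.
- move=> [i a] [j b] [k c] /=; rewrite /copies_adj /= => /andP[/eqP-> ab].
  by move=> /andP[/eqP-> bc]; rewrite eqxx /= (tf _ _ _ ab bc).
- move=> [i a] [j b] [k c] [l d] /=; rewrite /copies_adj /= => /andP[/eqP<- ab].
  move=> /andP[/eqP<- ac] /andP[/eqP<- ad]; rewrite !xpair_eqE eqxx /=.
  exact: cf ab ac ad.
- move=> [i a] [j b] [k c] [l d] /=; rewrite /copies_adj /= => /andP[/eqP-> ab].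
  move=> /andP[/eqP-> bc] /andP[/eqP-> cd]; rewrite !xpair_eqE eqxx /=.
  exact: pc ab bc cd.
Qed.

Lemma thin_cycle4 : thin (@adj (cycle_graph 4)).
Proof.
split; rewrite /= /cycle_adj.
- by move=> [[|[|[|[|a]]]] //= ?] [[|[|[|[|b]]]] //= ?] [[|[|[|[|c]]]] //= ?].
- by move=> [[|[|[|[|a]]]] //= ?] [[|[|[|[|b]]]] //= ?] [[|[|[|[|c]]]] //= ?]
    [[|[|[|[|d]]]] //= ?].
- by move=> [[|[|[|[|a]]]] //= ?] [[|[|[|[|b]]]] //= ?] [[|[|[|[|c]]]] //= ?]
    [[|[|[|[|d]]]] //= ?].
Qed.

Lemma thin_small_part (J : sgraph) : small_part J -> thin (@adj J).
Proof.
case=> [|[|[]]] ->.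
- by split=> -[].
- by split=> a b; rewrite /= /complete_adj !ord1.
- split; rewrite /= /complete_adj.
  + by move=> [[|[|a]] //= ?] [[|[|b]] //= ?] [[|[|c]] //= ?].
  + by move=> [[|[|a]] //= ?] [[|[|b]] //= ?] [[|[|c]] //= ?] [[|[|d]] //= ?].
  + by move=> [[|[|a]] //= ?] [[|[|b]] //= ?] [[|[|c]] //= ?] [[|[|d]] //= ?].
- split; rewrite /= /path_adj.
  + by move=> [[|[|[|a]]] //= ?] [[|[|[|b]]] //= ?] [[|[|[|c]]] //= ?].
  + by move=> [[|[|[|a]]] //= ?] [[|[|[|b]]] //= ?] [[|[|[|c]]] //= ?] [[|[|[|d]]] //= ?].
  + by move=> [[|[|[|a]]] //= ?] [[|[|[|b]]] //= ?] [[|[|[|c]]] //= ?] [[|[|[|d]]] //= ?].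
Qed.

(** * Degrees and deficiency *)

Lemma card_le2_claw_free {T : finType} {e : rel T} (x : T) :
  claw_free e -> (#|[set y | e x y]| <= 2)%N.
Proof.
move=> cf; rewrite leqNgt; apply/negP => /card_gt2P[b [c [d []]]].
move=> [] + + + []; rewrite !inE => xb xc xd bc cd db.
by have := cf _ _ _ _ xb xc xd; rewrite (negbTE bc) (negbTE cd) eq_sym (negbTE db).
Qed.

Lemma sum_deficiency {T : finType} {e : rel T} :
  claw_free e ->
  (\sum_(x in [set: T]) (2 - #|[set y | e x y]|) + \sum_x \sum_y e x y
     = #|T|.*2)%N.
Proof.
move=> cf; have deg x : #|[set y | e x y]| = (\sum_y e x y)%N.
  by rewrite -sum1dep_card big_mkcond; apply: eq_bigr => y _; case: (e x y).
rewrite (eq_bigl predT) => [|x]; last by rewrite inE.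
rewrite -big_split /= -muln2 -sum_nat_const.
(* Degrees are at most 2, so the truncated subtraction is exact. *)
by apply: eq_bigr => x _; rewrite -deg subnK // card_le2_claw_free.
Qed.

(** * The weighting and its graph of positive edges *)

Section Weighting.
Variables (n : nat) (f : edge (complete_graph n) -> int).
Hypothesis hf : forall e, f e = -1 \/ f e = 1.

Definition positive : rel 'I_n := fun x y => at_pair f x y == 1.

Lemma positive_sym : symmetric positive.
Proof. by move=> x y; rewrite /positive at_pair_sym. Qed.

Lemma at_pair_loop {V : nmodType} (g : edge (complete_graph n) -> V) x :
  at_pair g x x = 0.
Proof.
rewrite /at_pair; case: insubP => // e _ De.
have [a [b [ab]]] := edgeP e; rewrite De => Dab.
by have := cards2 a b; rewrite -Dab setUid cards1 (ab : a != b).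
Qed.

Lemma positive_irr : irreflexive positive.
Proof. by move=> x; rewrite /positive at_pair_loop. Qed.

(** Six weights thus add up to twice the number of positive pairs minus 6, which vanishes exactly
    for three positive pairs. *)
Lemma at_pair_positive x y : x != y -> at_pair f x y = (positive x y)%:R *+ 2 - 1.
Proof.
move=> xy; rewrite /positive (at_pairE f (xy : adj (s:=complete_graph n) x y)).
by set e := Sub _ _; case: (hf e) => ->.
Qed.

Lemma sum_positive :
  (\sum_x \sum_y positive x y = #|[set e | f e == 1]|.*2)%N.
Proof.
rewrite -[X in X.*2]sum1_card [X in X.*2]big_mkcond /= -addnn.
have := sum_at_pair (fun e => if e \in [set e | f e == 1] then 1%N else 0%N).
rewrite mulr2n => sum2; apply: etrans sum2.
apply: eq_bigr => x _; apply: eq_bigr => y _.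
by rewrite /positive /at_pair; case: insub => //= e; rewrite inE; case: eqP.
Qed.

Lemma spanning_adj (x y : vertex (spanning_subgraph [set e | f e == 1])) :
  adj x y = positive (val x) (val y).
Proof.
rewrite /positive /at_pair; case: insubP => [e _ De|nE]; rewrite [oapp _ _ _]/=.
  apply/exists_inP/idP => [[e']|fe]; last by exists e; rewrite ?inE // De.
  by rewrite inE -De => fe' /eqP/val_inj<-.
by apply/negbTE/exists_inP => -[e _ /eqP De]; case/negP: nE; rewrite -De; apply: valP.
Qed.

Lemma sum_four_edges (H : subgraph (complete_graph n)) a b c d :
  uniq [:: a; b; c; d] -> sub_vertices H =i [:: a; b; c; d] ->
  (forall x y, x \in sub_vertices H -> y \in sub_vertices H -> x != y ->
     exists2 e, e \in sub_edges H & val e = [set x; y]) ->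
  \sum_(e in sub_edges H) f e = at_pair f a b + at_pair f a c + at_pair f a d
    + at_pair f b c + at_pair f b d + at_pair f c d.
Proof.
(* Masking [f] outside [H] makes [sum_at_pair] applicable; only pairs among the four vertices then
   contribute. *)
move=> us Hs Hcomplete; pose g e := if e \in sub_edges H then f e else 0.
have outside x y : x \notin [:: a; b; c; d] -> at_pair g x y = 0.
  rewrite -Hs /at_pair => xH; case: insubP => //= e _ De; rewrite /g.
  case: ifP => // eH; have xe : x \in val e by rewrite (De : val e = [set x; y]) set21.
  by have := subsetP (sub_edgesP eH) x xe; rewrite (negbTE xH).
have inside x y : x \in [:: a; b; c; d] -> y \in [:: a; b; c; d] -> x != y ->
    at_pair g x y = at_pair f x y.
  rewrite -!Hs => xH yH xy; have [e eH De] := Hcomplete x y xH yH xy.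
  rewrite /at_pair; case: insubP => //= e' _; rewrite -De => /val_inj ->.
  by rewrite /g eH.
have: (\sum_(e in sub_edges H) f e) *+ 2 =
    \sum_(x <- [:: a; b; c; d]) \sum_(y <- [:: a; b; c; d]) at_pair g x y.
  rewrite big_mkcond -sum_at_pair [RHS]big_uniq // [LHS](bigID [in [:: a; b; c; d]]) /=.
  rewrite [X in _ + X]big1 ?addr0 => [|x xs]; last first.
    by apply: big1 => y _; apply: outside.
  apply: eq_bigr => x _; rewrite [RHS]big_uniq // [LHS](bigID [in [:: a; b; c; d]]) /=.
  rewrite [X in _ + X]big1 ?addr0 // => y ys.
  by rewrite at_pair_sym outside.
rewrite !big_cons !big_nil !at_pair_loop.
move: us; rewrite /= !inE !negb_or !andbT => /and3P[/and3P[ab ac ad] /andP[bc bd] cd].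
rewrite !(at_pair_sym g b a, at_pair_sym g c a, at_pair_sym g d a,
  at_pair_sym g c b, at_pair_sym g d b, at_pair_sym g d c).
rewrite !inside ?inE ?eqxx ?orbT //.
lia.
Qed.

Lemma no_three_edges_positive :
  (~ exists H : subgraph (complete_graph n),
       isomorphic H (complete_graph 4) /\ \sum_(e in sub_edges H) f e = 0)
  <-> no_three_edges positive.
Proof.
have sum0 a b c d : uniq [:: a; b; c; d] ->
  (at_pair f a b + at_pair f a c + at_pair f a d
    + at_pair f b c + at_pair f b d + at_pair f c d == 0) =
  (positive a b + positive a c + positive a d + positive b c + positive b d
    + positive c d == 3)%N.
  rewrite /= !inE !negb_or !andbT => /and3P[/and3P[ab ac ad] /andP[bc bd] cd].
  rewrite !at_pair_positive //.
  by do 6 case: positive.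
split=> [noH a b c d us|nt [H [[phi [psi phiK psiK] phiE] sumH]]].
  apply/negP; rewrite -sum0 // => /eqP s0; case: noH.
  pose S : {set vertex (complete_graph n)} := [set x in [:: a; b; c; d]].
  (* All edges inside [S] together form the copy of K_4. *)
  pose ES := [set e : edge (complete_graph n) | val e \subset S].
  have inS e : e \in ES -> val e \subset S by rewrite inE.
  exists (Subgraph inS); split; last first.
    rewrite (sum_four_edges (Subgraph inS) a b c d) // => [x|x y xS yS xy].
      by rewrite /= inE.
    exists (Sub [set x; y] (adj_edges (xy : adj (s:=complete_graph n) x y))) => //.
    by rewrite inE /= subUset !sub1set xS.
  have cS : #|{: {x : 'I_n | x \in S}}| = 4.
    by rewrite card_sig; apply: etrans (card_uniqP us); apply: eq_card => x; rewrite !inE.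
  exists (fun x => cast_ord cS (enum_rank x)).
    exists (fun i => enum_val (cast_ord (esym cS) i)) => x.
      by rewrite cast_ordK enum_rankK.
    by rewrite enum_valK cast_ordKV.
  move=> x y /=; rewrite /complete_adj (inj_eq (@cast_ord_inj _ _ _)) (inj_eq enum_rank_inj).
  apply/idP/idP => [xy|]; last by apply: contraTneq => ->; rewrite sub_adj_irr.
  apply/exists_inP.
    exists (Sub [set val x; val y] (adj_edges (xy : adj (s:=complete_graph n) (val x) (val y)))) => //.
    by rewrite inE /= subUset !sub1set (valP x) (valP y).
(* The inverse isomorphism lists the four vertices of [H]. *)
pose p i : 'I_n := val (psi i).
have p_inj : injective p by move=> i j /val_inj/(can_inj psiK).
pose o i (lt_i : (i < 4)%N) := p (Ordinal lt_i).
have us : uniq [:: o 0%N isT; o 1%N isT; o 2 isT; o 3 isT].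
  by rewrite /= !inE !(inj_eq p_inj).
have := nt _ _ _ _ us; rewrite -sum0 // -(sum_four_edges H) ?sumH ?eqxx // => [x|x y xH yH xy].
  apply/idP/idP => [xH|]; last by rewrite !inE => /or4P[]/eqP->; apply: valP.
  have -> : x = p (phi (Sub x xH)) by rewrite /p phiK.
  by rewrite !inE !(inj_eq p_inj); case: (phi _) => [[|[|[|[|i]]]]].
have := phiE (Sub x xH) (Sub y yH); rewrite /= /complete_adj (can_eq phiK) -(inj_eq val_inj) /= xy.
by move=> /esym/exists_inP[e eH /eqP De]; exists e.
Qed.

End Weighting.

(** * The characterization *)

Lemma card_small_part (J : sgraph) : small_part J -> (#|vertex J| < 4)%N.
Proof. by case=> [|[|[]]] ->; rewrite card_ord. Qed.

Theorem theorem8 (n : nat) (hn : (5 <= n)%N)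
    (f : edge (complete_graph n) -> int)
    (hf : forall e, f e = -1 \/ f e = 1)
    (hcard : #|[set e | f e == 1]| = (h n - 1)%N) :
  (~ exists H : subgraph (complete_graph n),
       isomorphic H (complete_graph 4) /\ \sum_(e in sub_edges H) f e = 0)
  <->
  (exists J : sgraph,
     (J = complete_graph 0 \/ J = complete_graph 1 \/
      J = complete_graph 2 \/ J = path_graph 2) /\
     isomorphic (spanning_subgraph [set e | f e == 1])
       (disjoint_union J (disjoint_copies (cycle_graph 4) (n %/ 4)))).
Proof.
have sum2 := sum_positive n f; rewrite hcard in sum2.
(* At most [n] positive edges exclude triangles; at least [n - 1] keep the total deficiency at most
   2. *)
have h_bounds : (n <= (h n - 1).+1 <= n.+1)%N by rewrite /h; case: ifP; lia.
have ps := positive_sym n f; have pi := positive_irr n f.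
rewrite no_three_edges_positive //; split=> [nt|[J [sJ [phi [psi phiK psiK] phiE]]]].
  have tf : triangle_free (positive n f).
    apply: no_three_edges_triangle_free => //; rewrite ?card_ord //.
    by rewrite sum2; move: h_bounds; lia.
  have th := no_three_edges_thin ps pi nt tf.
  have [_ cf _] := th.
  have [||J [q [sJ [phi [phi_inj imphi phiE]]]]] := thin_decomposition _ _ [set: 'I_n] ps pi th.
  - by [].
  - have := sum_deficiency cf; rewrite sum2 => def.
    rewrite -(leq_add2r (h n - 1).*2) [leqLHS]def card_ord; move: h_bounds; lia.
  (* Counting vertices gives [n] as [4 q] plus the order of [J], which is below 4. *)
  have Dq : (n %/ 4)%N = q.
    have : #|{: vertex J + 'I_q * 'I_4}| = n.
      have <- : #|codom phi| = n by rewrite (eq_card imphi) cardsT card_ord.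
      exact/esym/card_codom.
    rewrite card_sum card_prod !card_ord => <-.
    by rewrite addnC divnMDl // divn_small ?addn0 // card_small_part.
  exists J; rewrite Dq; split=> //.
  have phi_onto x : {u | phi u = x}.
    have : x \in codom phi by rewrite imphi inE.
    by move=> xphi; exists (iinv xphi); apply: f_iinv.
  exists (fun x => sval (phi_onto (val x))).
    exists (fun u => Sub (phi u) (in_setT (phi u))) => [x|u] /=.
      by apply: val_inj; rewrite /= (svalP (phi_onto (val x))).
    by apply: phi_inj; rewrite (svalP (phi_onto _)).
  move=> x y; rewrite spanning_adj // -phiE.
  by rewrite (svalP (phi_onto (val x))) (svalP (phi_onto (val y))).
apply: thin_no_three_edges => //.
(* The spanning subgraph lives on a subtype of ['I_n]; [chi] transfers thinness back to ['I_n]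
   itself. *)
pose chi (x : 'I_n) := phi (Sub x (in_setT x)).
have chi_inj : injective chi.
  by move=> x y /(can_inj phiK)/(congr1 val).
have posE x y : positive n f x y = adj (chi x) (chi y) by rewrite phiE spanning_adj.
have thG := thin_disjoint_union J _ (thin_small_part J sJ)
  (thin_disjoint_copies _ (n %/ 4) thin_cycle4).
have [tf cf pc] := thin_relpre chi chi_inj thG.
split=> [a b c|a b c d|a b c d]; rewrite !posE; [exact: tf|exact: cf|exact: pc].
Qed.
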